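(* Let $(\Omega,\Sigma,\mu)$ be a localizable measure space, and regard $L_\infty(\mu)=L_1(\mu)^*$. The following assertions are equivalent: (1) $L_\infty(\mu)$ has property (W$^*$1): every convex combination of weak-star slices of $B_{L_\infty(\mu)}$ is relatively weak-star open in $B_{L_\infty(\mu)}$. (2) $L_\infty(\mu)$ has property (W$^*$2): the relative weak-star interior (in $B_{L_\infty(\mu)}$) of each convex combination of weak-star slices of $B_{L_\infty(\mu)}$ is not empty. (3) $\mu$ is purely atomic.
   Context: All Banach spaces are real. For a dual Banach space $X=Y^*$, $B_X$ and $S_X$ denote the closed unit ball and unit sphere, and the weak-star topology is $\sigma(Y^*,Y)$. A weak-star slice of $B_{Y^*}$ is a set $\{x\in B_{Y^*}: x(y)>1-\alpha\}$ with $y\in S_Y$ and $\alpha>0$. A convex combination of weak-star slices is a set $\sum_{i=1}^n\lambda_i S_i$ (Minkowski sum), where $\lambda_1,\dots,\lambda_n\in[0,1]$, $\sum_{i=1}^n\lambda_i=1$, and each $S_i$ is a weak-star slice of $B_{Y^*}$. Here $Y=L_1(\mu)$. A measure space is localizable if it is semifinite and every family of measurable sets has an essential supremum in $\Sigma$ (so that $L_1(\mu)^*=L_\infty(\mu)$ canonically). $\mu$ is purely atomic if every measurable set of positive measure contains an atom of $\mu$. *)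

(* Defs.v *)
From HB Require Import structures.
From mathcomp Require Import all_boot all_order all_algebra.
From mathcomp Require Import all_classical all_reals all_analysis.

Set Implicit Arguments.
Unset Strict Implicit.
Unset Printing Implicit Defensive.
Import Order.TTheory GRing.Theory Num.Theory.
Import numFieldTopology.Exports.

Local Open Scope classical_set_scope.
Local Open Scope ring_scope.

Section measure_properties.
Context d (T : measurableType d) (R : realType).
Variable mu : {measure set T -> \bar R}.
Local Open Scope ereal_scope.

Definition semifinite_measure :=
  forall A : set T, measurable A -> mu A = +oo ->
    exists B : set T, [/\ measurable B, B `<=` A & 0 < mu B < +oo].

Definition is_essential_supremum (F : set (set T)) (H : set T) :=
  [/\ measurable H,
      (forall E, F E -> mu (E `\` H) = 0) &
      (forall G, measurable G -> (forall E, F E -> mu (E `\` G) = 0) ->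
         mu (H `\` G) = 0)].

Definition localizable :=
  semifinite_measure /\
  (forall F : set (set T), F `<=` measurable ->
     exists H, is_essential_supremum F H).

Definition atom (A : set T) :=
  [/\ measurable A, 0 < mu A &
      (forall B, measurable B -> B `<=` A -> mu B = 0 \/ mu (A `\` B) = 0)].

Definition purely_atomic :=
  forall A : set T, measurable A -> 0 < mu A ->
    exists2 B : set T, B `<=` A & atom B.

End measure_properties.

Section Lspace_choice.
Context d (T : measurableType d) (R : realType).
Variables (mu : {measure set T -> \bar R}) (p : \bar R) (p1 : (1 <= p)%E).

HB.instance Definition _ := gen_eqMixin (LspaceType mu p1).
HB.instance Definition _ := gen_choiceMixin (LspaceType mu p1).

End Lspace_choice.

Section weak_star.
Context d (T : measurableType d) (R : realType).
Variable mu : {measure set T -> \bar R}.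

(* Elements of [LspaceType] are classes modulo a.e. equality; they coerce to
   functions through a representative. All definitions below depend on the
   class only. *)
Definition L1 : choiceType := LspaceType mu (lexx 1%E).
Definition Linfty : choiceType := LspaceType mu (leey 1%E).

(* the functional on L_1(mu) represented by [g] *)
Definition duality (g : Linfty) : prod_topology (fun _ : L1 => R) :=
  fun f : L1 => \int[mu]_x (f x * g x).

(* [Linfty] with the topology sigma(L_oo(mu), L_1(mu)) *)
Definition weak_star : Type := initial_topology duality.

HB.instance Definition _ :=
  Topological.copy weak_star (initial_topology duality).

Definition L1_sphere : set L1 := [set f | 'N[mu]_1[EFin \o f] = 1%:E]%E.

Definition Linfty_ball : set Linfty :=
  [set g | 'N[mu]_+oo[EFin \o g] <= 1%:E]%E.

Definition weak_star_slice (S : set Linfty) :=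
  exists f : L1, exists alpha : R,
    [/\ L1_sphere f, 0 < alpha &
        S = [set g | Linfty_ball g /\ 1 - alpha < duality g f]].

(* the Minkowski sum \sum_i lambda_i S_i in the vector space L_oo(mu), whose
   operations are pointwise almost everywhere *)
Definition minkowski_combination (n : nat) (lambda : 'I_n -> R)
    (S : 'I_n -> set Linfty) : set Linfty :=
  [set h | exists2 g : 'I_n -> Linfty, (forall i, S i (g i)) &
     (h : T -> R) = (fun x => \sum_(i < n) lambda i * g i x) %[ae mu]].

Definition convex_combination_of_slices (C : set Linfty) :=
  exists (n : nat) (lambda : 'I_n -> R) (S : 'I_n -> set Linfty),
    [/\ (forall i, 0 <= lambda i <= 1),
        \sum_(i < n) lambda i = 1,
        (forall i, weak_star_slice (S i)) &
        C = minkowski_combination lambda S].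

(* [subspace A] carries the relative topology on [A] and is discrete off [A];
   the sets [C] below are contained in the unit ball, so that [open] and
   [interior] in the subspace are the relative notions. *)
Definition property_Wstar1 :=
  forall C : set Linfty, convex_combination_of_slices C ->
    open (C : set (subspace (Linfty_ball : set weak_star))).

Definition property_Wstar2 :=
  forall C : set Linfty, convex_combination_of_slices C ->
    interior (C : set (subspace (Linfty_ball : set weak_star))) !=set0.

End weak_star.

(* Main.v *)
From HB Require Import structures.
Require Import Defs.
From mathcomp Require Import all_boot all_order all_algebra.
From mathcomp Require Import all_classical all_reals all_analysis.
From mathcomp Require Import measurable_realfun ess_sup_inf measure_negligible.
From mathcomp Require Import lra.

Set Implicit Arguments.
Unset Strict Implicit.
Unset Printing Implicit Defensive.
Import Order.TTheory GRing.Theory Num.Theory.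
Import numFieldTopology.Exports.

Local Open Scope classical_set_scope.
Local Open Scope ring_scope.

(** A convex combination of slices is weak-star open when every small perturbation
    of an average lifts to small perturbations of its terms. This works when
    weak-star convergence in the unit ball makes integrals of absolute values
    converge, which it does over atoms but not over atomless sets.

    From purely atomic to (W*1). Let h = sum_i lambda_i g_i with g_i in the
    slice S_i. The real function [lift_mean] lifts a perturbation h' of h
    pointwise: it produces w_i with values in [-1, 1] such that
    sum_i lambda_i w_i = h' and lambda_i |w_i - g_i| <= |h' - h|. The w_i stay
    in their slices as soon as the integrals of |f_i| |h' - h| are small, where
    f_i defines S_i. On an atom a measurable function has almost everywhere a
    constant sign, so there the integral of |f (h' - h)| is the absolute value
    of the integral of f (h' - h), which is weak-star small; an exhaustion by
    finite unions of atoms reduces the integral over the whole space to this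
    case ([purely_atomic_near]).

    (W*1) implies (W*2) because slices are not empty.

    From (W*2) to purely atomic. Otherwise semifiniteness gives a set B of
    finite positive measure that contains no atom. Let f = 1_B / mu(B), and let C
    be the average of the slices {g : int g f > 0} and {g : - int g f > 0}. An
    element k of C with |k| = 1 almost everywhere on B is the midpoint there of two
    functions bounded by 1, hence both equal k on B, and int_B k would be both
    positive and negative. So C contains no such k. But on an atomless set the
    unimodular functions are weak-star dense in the ball
    ([atomless_dense_unimodular]): after approximating the test functions by
    simple functions, it suffices to prescribe the integral of a function with
    values 1 and -1 on each of finitely many pieces of B, which is Sierpinski's
    intermediate value theorem for atomless measures
    ([atomless_intermediate_value]). Hence C has empty interior. *)

(** * Exhaustion *)

Section exhaustion.
Context {T : Type} {R : realType}.

(** The Brezis-Browder ordering principle for sets: choosing [D n.+1] above [D n]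
    with [phi (D n.+1)] within [1 / n.+1] of the supremum of [phi] over all
    members of [P] above [D n], the union of the sequence cannot be improved.
    It serves both to exhaust a measure by atoms and to construct a subset of
    prescribed measure. *)
Lemma exhaustion (P : set (set T)) (phi : set T -> R) (c : R) (A0 : set T) :
    P A0 ->
    (forall D : (set T)^nat, (forall n, P (D n)) ->
       (forall n, D n `<=` D n.+1) -> P (\bigcup_n D n)) ->
    (forall A B, P A -> P B -> A `<=` B -> phi A <= phi B) ->
    (forall A, P A -> phi A <= c) ->
  exists2 M, P M & forall E, P E -> M `<=` E -> phi E <= phi M.
Proof.
move=> PA0 Pcup phi_mono phi_le.
pose above A := [set phi E | E in [set E | P E /\ A `<=` E]].
have above_sup A : P A -> has_sup (above A).
  move=> PA; split; first by exists (phi A); exists A => //; split.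
  by exists c => _ [E [PE _] <-]; exact: phi_le.
have step (nA : nat * {A | P A}) : exists B : {A | P A},
    sval nA.2 `<=` sval B /\ sup (above (sval nA.2)) - nA.1.+1%:R^-1 < phi (sval B).
  case: nA => n [A PA] /=.
  have n0 : 0 < n.+1%:R^-1 :> R by rewrite invr_gt0.
  by have [_ [B [PB AB] <-] lt] := sup_adherent n0 (above_sup A PA); exists (exist _ B PB).
have [next nextP] := choice step.
pose D := fix D n := if n is m.+1 then next (m, D m) else exist _ A0 PA0.
have DS n : sval (D n) `<=` sval (D n.+1) by have [] := nextP (n, D n).
have PM : P (\bigcup_n sval (D n)) by apply: Pcup => // n; exact: svalP.
exists (\bigcup_n sval (D n)) => // E PE ME.
rewrite leNgt; apply/negP => lt.
have [n] := ltr_add_invr lt.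
apply/negP; rewrite -leNgt -lerBlDr.
have [_ /= /ltW nP] := nextP (n, D n).
apply: le_trans (phi_mono _ _ (svalP (D n.+1)) PM _); last by move=> x ?; exists n.+1.
apply: le_trans nP; rewrite lerD2r.
apply: (sup_upper_bound (above_sup _ (svalP (D n)))); exists E => //; split => //.
by apply: subset_trans ME => x ?; exists n.
Qed.

End exhaustion.

(** * Representatives of classes *)

Section classes.
Context d (T : measurableType d) (R : realType) (mu : {measure set T -> \bar R}).
Implicit Types (u v f : T -> R) (g h : Linfty mu) (A B E : set T).

(** A class in the unit ball has a representative bounded by 1 almost everywhere
    only; truncation makes the bound hold everywhere, so that the pointwise
    constructions below need no exceptional set. *)
Definition clip u (x : T) : R := Num.max (-1) (Num.min 1 (u x)).

Lemma clip_le1 u x : `|clip u x| <= 1.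
Proof. by rewrite ler_norml /clip le_max lexx/= ge_max ge_min lexx/=; lra. Qed.

Lemma clip_id u x : `|u x| <= 1 -> clip u x = u x.
Proof. by rewrite ler_norml /clip => /andP[? ?]; rewrite min_r// max_r. Qed.

Lemma measurable_clip u : measurable_fun setT u -> measurable_fun setT (clip u).
Proof. by move=> mfu; apply: measurable_maxr => //; apply: measurable_minr. Qed.

Lemma L1_measurable (f : L1 mu) : measurable_fun setT (f : T -> R).
Proof.
move=> mT Y mY.
exact: (measurable_funPT (repr (f : {mfun_ mu, T >-> measurableTypeR R})) mT Y mY).
Qed.

Lemma Linfty_measurable g : measurable_fun setT (g : T -> R).
Proof.
move=> mT Y mY.
exact: (measurable_funPT (repr (g : {mfun_ mu, T >-> measurableTypeR R})) mT Y mY).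
Qed.

Lemma L1_integrable (f : L1 mu) : mu.-integrable setT (EFin \o (f : T -> R)).
Proof.
apply/Lfun1_integrable; rewrite inE; apply/andP; split; rewrite inE/=.
  exact: L1_measurable.
exact: Lebesgue_finite.
Qed.

Lemma ae_class_of u : measurable_fun setT u ->
  exists Q : {mfun_ mu, T >-> measurableTypeR R},
    measurable_fun setT (Q : T -> R) /\ (Q : T -> R) = u %[ae mu].
Proof.
move=> mfu.
have mu' : measurable_fun setT (u : T -> measurableTypeR R) by move=> mT Y mY; exact: mfu.
pose mF := isMeasurableFun.Build _ _ _ _ (u : T -> measurableTypeR R) mu'.
pose F : {mfun T >-> measurableTypeR R} := HB.pack (u : T -> measurableTypeR R) mF.
pose Q : {mfun_ mu, T >-> measurableTypeR R} := \pi_({mfun_ mu, T >-> measurableTypeR R})%qT F.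
exists Q; split; first by move=> mT Y mY; exact: (measurable_funPT (repr Q) mT Y mY).
have : (repr Q == F %[mod {mfun_ mu, T >-> measurableTypeR R}])%qT by rewrite reprK.
by rewrite eqmodE => /asboolP.
Qed.

Lemma L1_class f : mu.-integrable setT (EFin \o f) ->
  exists k : L1 mu, (k : T -> R) = f %[ae mu].
Proof.
move=> fi; have mf : measurable_fun setT f by exact/measurable_EFinP/(measurable_int mu).
have [Q [mQ Qf]] := ae_class_of mf.
have fin : finite_norm mu 1 Q.
  rewrite /finite_norm Lnorm1.
  rewrite (@ge0_ae_eq_integral _ _ _ mu setT _ (abse \o (EFin \o f)))//.
  - by case/integrableP : fi.
  - by apply/measurableT_comp => //; apply/measurable_EFinP.
  - by apply/measurableT_comp => //; apply/measurable_EFinP.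
  - by move=> x _ /=.
  - by apply: filterS Qf => x /= /[apply] ->.
pose mK := isFinLebesgue.Build d T R mu 1%E (lexx 1%E) Q fin.
pose K : LspaceType mu (lexx 1%E) := HB.pack Q mK.
by exists K.
Qed.

Lemma Linfty_normP u : measurable_fun setT u -> forall c : R, 0 <= c ->
  ('N[mu]_+oo[EFin \o u] <= c%:E)%E <-> {ae mu, forall x, `|u x| <= c}.
Proof.
move=> mfu c c0; rewrite unlock /Lnorm; case: ifPn => [mu0|].
  split=> [/ess_supP|H]; last apply/ess_supP.
    by apply: filterS => x /=; rewrite lee_fin.
  by apply: filterS H => x /=; rewrite lee_fin.
rewrite -leNgt => mu0; split=> // _; exists setT; split => //.
by apply/eqP; rewrite eq_le mu0/=.
Qed.

Lemma ballP g : Linfty_ball g <-> {ae mu, forall x, `|g x| <= 1}.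
Proof. exact: (Linfty_normP (Linfty_measurable g) ler01). Qed.

Lemma Linfty_class u : measurable_fun setT u -> (forall x, `|u x| <= 1) ->
  exists2 g : Linfty mu, Linfty_ball g & (g : T -> R) = u %[ae mu].
Proof.
move=> mfu u1.
have [Q [mQ Qu]] := ae_class_of mfu.
have N1 : ('N[mu]_+oo[EFin \o Q] <= 1%:E)%E.
  by apply/(Linfty_normP mQ ler01); apply: filterS Qu => x ->.
have fin : finite_norm mu +oo%E Q by rewrite /finite_norm (le_lt_trans N1)// ltry.
pose mK := isFinLebesgue.Build d T R mu +oo%E (leey 1%E) Q fin.
pose K : LspaceType mu (leey 1%E) := HB.pack Q mK.
by exists K.
Qed.

Lemma ball_clip g : Linfty_ball g -> (g : T -> R) = clip g %[ae mu].
Proof.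
move=> /ballP.
by apply: filterS => x /clip_id ->.
Qed.

Lemma integrable_bounded f u c E : measurable E -> mu.-integrable setT (EFin \o f) ->
  measurable_fun setT u -> (forall x, `|u x| <= c) ->
  mu.-integrable E (EFin \o (fun x => f x * u x)).
Proof.
move=> mE fi mfu uc; apply: (@integrableS _ _ _ _ setT) => //.
have mf : measurable_fun setT f by exact/measurable_EFinP/(measurable_int mu).
apply: (@le_integrable _ _ _ mu setT _ _ (EFin \o (fun x => c * f x))) => //.
- by apply/measurable_EFinP; exact: measurable_funM.
- move=> x _ /=; rewrite lee_fin !normrM mulrC ler_wpM2r//.
  by rewrite (le_trans (uc x))// ler_norm.
- exact: (integrableZl measurableT c fi).
Qed.

Lemma ae_eq_Rintegral E u v : measurable E -> measurable_fun setT u ->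
  measurable_fun setT v -> u = v %[ae mu] ->
  \int[mu]_(x in E) u x = \int[mu]_(x in E) v x.
Proof.
move=> mE mfu mv uv; congr fine; apply: ae_eq_integral => //.
- by apply/measurable_EFinP; apply: measurable_funTS.
- by apply/measurable_EFinP; apply: measurable_funTS.
- by apply: filterS uv => x uvx _ /=; rewrite uvx.
Qed.

End classes.

(** * Weak-star neighbourhoods *)

Section weak_star_nbhs.
Context d (T : measurableType d) (R : realType) (mu : {measure set T -> \bar R}).

Lemma duality_continuous (f : L1 mu) :
  continuous (fun h : weak_star mu => duality h f).
Proof.
move=> h; apply: (@continuous_comp (weak_star mu) (prod_topology (fun _ : L1 mu => R)) R
   (@duality d T R mu) (fun k => k f)).
  exact: initial_continuous.
exact: proj_continuous.
Qed.

Lemma near_duality (h : weak_star mu) (f : L1 mu) (e : R) : 0 < e ->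
  \forall k \near h, `|duality k f - duality h f| < e.
Proof.
move=> e0; have /cvgrPdist_lt /(_ e e0) := @duality_continuous f h.
by apply: filterS => k; rewrite distrC.
Qed.

(** Stated for filters, this avoids describing neighbourhoods in the initial and
    product topologies by finite intersections. *)
Lemma weak_star_cvg (F : set_system (weak_star mu)) (h : weak_star mu) : Filter F ->
  (forall (f : L1 mu) (e : R), 0 < e ->
     F [set k | `|duality k f - duality h f| < e]) ->
  F --> h.
Proof.
move=> FF Fh.
have H : @duality d T R mu @ F --> (duality h : prod_topology (fun _ : L1 mu => R)).
  apply/cvg_sup => f U [_ [[B oB <-] Bh BU]].
  have /cvgrPdist_lt : forall e, 0 < e -> \forall k \near F, `|duality h f - duality k f| < e.
    by move=> e e0; apply: filterS (Fh f e e0) => k; rewrite distrC.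
  move=> /(_ B (open_nbhs_nbhs (conj oB Bh))) FB.
  by apply: (@filterS _ F) FB => k Bk; exact: BU.
move=> A [_ [[B oB <-] Bh BA]].
have FB := H B (open_nbhs_nbhs (conj oB Bh)).
by apply: (@filterS _ F) FB => k Bk; exact: BA.
Qed.

End weak_star_nbhs.

(** * Weak-star convergence over atoms *)

Section atoms.
Context d (T : measurableType d) (R : realType) (mu : {measure set T -> \bar R}).

(** The set where [u >= 0] is null or conull in the atom, so that [u] has almost
    everywhere a constant sign there. *)
Lemma atom_normr_Rintegral A (u : T -> R) : atom mu A ->
    measurable_fun setT u -> mu.-integrable A (EFin \o u) ->
  \int[mu]_(x in A) `|u x| = `|\int[mu]_(x in A) u x|.
Proof.
move=> [mA _ Aatom] mfu ui.
have mnu : measurable_fun setT (fun x => `|u x|) by exact: measurableT_comp.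
pose N := A `&` [set x | 0 <= u x].
have mN : measurable N.
  rewrite /N setIC; apply: measurableI => //.
  rewrite (_ : mkset _ = setT `&` u @^-1` `[0, +oo[%classic).
    exact: mfu.
  by apply/seteqP; split => x /=; rewrite in_itv/= andbT => -[].
have NA : N `<=` A by move=> x [].
have [N0|N0] := Aatom N mN NA.
  (* [u] is negative almost everywhere on the atom *)
  have E : \int[mu]_(x in A) `|u x| = - \int[mu]_(x in A) u x.
    transitivity (\int[mu]_(x in A) (- 1 * u x)); last first.
      by rewrite RintegralZl// mulN1r.
    under [RHS]eq_Rintegral do rewrite mulN1r.
    congr fine; apply: ae_eq_integral => //.
    - by apply/measurable_EFinP; apply: measurable_funTS.
    - by apply/measurable_EFinP; apply: measurable_funTS; exact: measurableT_comp.
    exists N; split => // x /=; apply: contra_notP => nN Ax.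
    have : ~ 0 <= u x by move=> ux; apply: nN.
    by move=> /negP; rewrite -ltNge => /ltW ux; rewrite ler0_norm.
  by rewrite -[RHS]normrN -E ger0_norm // Rintegral_ge0.
have E : \int[mu]_(x in A) `|u x| = \int[mu]_(x in A) u x.
  congr fine; apply: ae_eq_integral => //.
  - by apply/measurable_EFinP; apply: measurable_funTS.
  - by apply/measurable_EFinP; apply: measurable_funTS.
  exists (A `\` N); split => //; first exact: measurableD.
  move=> x /=; apply: contra_notP => nN Ax.
  have [ux|ux] := leP 0 (u x); first by rewrite ger0_norm.
  by exfalso; apply: nN; split => // -[_ /=]; rewrite leNgt ux.
by rewrite -E ger0_norm // Rintegral_ge0.
Qed.

Lemma subset_Rintegral A B (u : T -> R) : measurable A -> measurable B -> A `<=` B ->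
  mu.-integrable B (EFin \o u) -> (forall x, 0 <= u x) ->
  \int[mu]_(x in A) u x <= \int[mu]_(x in B) u x.
Proof.
move=> mA mB AB ui u0; have uA := integrableS mB mA AB ui.
apply: fine_le; [exact: integrable_fin_num|exact: integrable_fin_num|].
apply: ge0_subset_integral => //; first exact: (measurable_int mu).
by move=> x _; rewrite lee_fin.
Qed.

Lemma Rintegral_setD A B (u : T -> R) : measurable A -> measurable B -> A `<=` B ->
  mu.-integrable B (EFin \o u) ->
  \int[mu]_(x in B) u x = \int[mu]_(x in A) u x + \int[mu]_(x in B `\` A) u x.
Proof.
move=> mA mB AB ui; rewrite -Rintegral_setU ?setDUK//.
- exact: measurableD.
- by apply/disj_setPS => x [? []].
Qed.

Lemma dualityE (F : L1 mu) (f : T -> R) (k : Linfty mu) : measurable_fun setT f ->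
  (F : T -> R) = f %[ae mu] -> Linfty_ball k ->
  duality k F = \int[mu]_x (f x * clip k x).
Proof.
move=> mf Ff kb; apply: ae_eq_Rintegral => //.
- by apply: measurable_funM; [exact: L1_measurable|exact: Linfty_measurable].
- by apply: measurable_funM => //; apply: measurable_clip; exact: Linfty_measurable.
- by apply: filterS2 Ff (ball_clip kb) => x Fx kx _; rewrite Fx// kx.
Qed.

(** Call a set good if the conclusion holds for the integral over it. Atoms are
    good by [atom_normr_Rintegral]; finite unions are good, and so are
    increasing countable ones, since the integrand is at most [2 * `|f|] and the
    tails of the integral of [`|f|] are small. A good set that carries the largest
    possible part of this integral carries all of it: otherwise its complement would
    contain an atom on which [f] does not vanish, and this atom could be added. *)
Lemma purely_atomic_near (f : T -> R) (h : weak_star mu) (e : R) :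
    purely_atomic mu -> mu.-integrable setT (EFin \o f) -> Linfty_ball h -> 0 < e ->
  \forall k \near h, Linfty_ball k ->
    \int[mu]_x (`|f x| * `|clip k x - clip h x|) < e.
Proof.
move=> pa fi hb e0.
have mf : measurable_fun setT f by exact/measurable_EFinP/(measurable_int mu).
have mclip (k : Linfty mu) : measurable_fun setT (clip k).
  by apply: measurable_clip; exact: Linfty_measurable.
have mdiff (k : Linfty mu) : measurable_fun setT (fun x => clip k x - clip h x).
  exact: measurable_funB.
have diff_le2 (k : Linfty mu) x : `|clip k x - clip h x| <= 2.
  by rewrite (le_trans (ler_normB _ _))// (_ : 2 = 1 + 1)// lerD// clip_le1.
have nfi : mu.-integrable setT (EFin \o (fun x => `|f x|)) by exact: integrable_abse fi.
pose w k x := `|f x| * `|clip k x - clip h x|.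
have w0 k x : 0 <= w k x by rewrite mulr_ge0.
have wi E (k : Linfty mu) : measurable E -> mu.-integrable E (EFin \o w k).
  move=> mE; apply: (@integrable_bounded _ _ _ mu _ _ 2) => //.
    exact: measurableT_comp.
  by move=> x; rewrite normr_id.
have w_le E (k : Linfty mu) : measurable E ->
    \int[mu]_(x in E) w k x <= 2 * \int[mu]_(x in E) `|f x|.
  move=> mE; rewrite -RintegralZl//; last exact: integrableS nfi.
  apply: le_Rintegral => //; first exact: wi.
    exact: (integrableZl mE 2 (integrableS measurableT mE (@subsetT _ _) nfi)).
  by move=> x _; rewrite /w mulrC ler_wpM2r.
pose good E := measurable E /\ forall e, 0 < e ->
  \forall k \near h, Linfty_ball k -> \int[mu]_(x in E) w k x < e.
have good_atom A : atom mu A -> good A.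
  move=> Aat; have [mA _ _] := Aat; split=> // {}e {}e0.
  have fAi : mu.-integrable setT (EFin \o (f \_ A)).
    rewrite -restrict_EFin; apply/(integrable_mkcond _ mA).
    exact: integrableS fi.
  have mfA : measurable_fun setT (f \_ A) by exact/measurable_EFinP/(measurable_int mu).
  have [F Ff] := L1_class fAi.
  apply: filterS (near_duality h F e0) => k /[swap] kb.
  rewrite !(dualityE mfA Ff)// -RintegralB//; last 2 first.
  - by apply: (@integrable_bounded _ _ _ mu _ _ 1) => //; exact: clip_le1.
  - by apply: (@integrable_bounded _ _ _ mu _ _ 1) => //; exact: clip_le1.
  apply: le_lt_trans.
  under eq_Rintegral do rewrite /w -normrM.
  rewrite atom_normr_Rintegral//; last 2 first.
  - by apply: measurable_funM.
  - by apply: (@integrable_bounded _ _ _ mu _ _ 2).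
  rewrite Rintegral_mkcond le_eqVlt; apply/orP; left; apply/eqP; congr `| _ |.
  apply: eq_Rintegral => x _; rewrite /patch.
  by case: ifP => _; rewrite ?mulrBr// !mul0r subr0.
have good_U A B : good A -> good B -> good (A `|` B).
  move=> [mA gA] [mB gB]; have mAB := measurableU _ _ mA mB.
  split=> // {}e {}e0; have e2 : 0 < e / 2 by rewrite divr_gt0.
  apply: filterS2 (gA _ e2) (gB _ e2) => k Ak Bk kb.
  rewrite (Rintegral_setD mA mAB) //; last exact: wi.
  rewrite [ltRHS]splitr.
  apply: ltrD (Ak kb) _; apply: le_lt_trans (Bk kb).
  apply: subset_Rintegral => //; [exact: measurableD| |exact: wi].
  by move=> x [[]].
have good_cup (D : (set T)^nat) : (forall n, good (D n)) ->
    (forall n, D n `<=` D n.+1) -> good (\bigcup_n D n).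
  move=> gD DS; have mD n : measurable (D n) by case: (gD n).
  have mU : measurable (\bigcup_n D n) by exact: bigcupT_measurable.
  split=> // {}e {}e0.
  have ndD : nondecreasing_seq D.
    by apply/nondecreasing_seqP => n; apply/subsetPset; exact: DS.
  have : (fun n => \int[mu]_(x in D n) `|f x|) @ \oo --> \int[mu]_(x in \bigcup_n D n) `|f x|.
    apply: fine_cvg; rewrite fineK; last first.
      by apply: integrable_fin_num => //; exact: integrableS nfi.
    apply: ge0_nondecreasing_set_cvg_integral => //.
    by move=> i; apply/measurable_EFinP; apply: measurable_funTS; exact: measurableT_comp.
  have e4 : 0 < e / 4 by rewrite divr_gt0.
  move=> /cvgrPdist_lt /(_ _ e4) [n _ /(_ n (leqnn n))] /=.
  have DnU : D n `<=` \bigcup_n D n by move=> x; exists n.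
  rewrite (Rintegral_setD (mD n) mU) //; last exact: integrableS nfi.
  rewrite addrC addKr ger0_norm; last exact: Rintegral_ge0.
  move=> tail.
  have e2 : 0 < e / 2 by rewrite divr_gt0.
  apply: filterS ((gD n).2 _ e2) => k Dk kb.
  rewrite (Rintegral_setD (mD n) mU) //; last exact: wi.
  rewrite [ltRHS]splitr.
  apply: ltr_leD (Dk kb) _.
  apply: le_trans (w_le _ _ _) _; first exact: measurableD.
  lra.
have good0 : good set0.
  by split=> // {}e {}e0; apply: (@filterE _ (nbhs h)) => k _; rewrite Rintegral_set0.
have [||M [mM gM] Mmax] := @exhaustion T R good (fun E => \int[mu]_(x in E) `|f x|)
    (\int[mu]_x `|f x|) set0 good0 good_cup.
- by move=> A B [mA _] [mB _] AB; apply: subset_Rintegral => //; exact: integrableS nfi.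
- by move=> A [mA _]; apply: subset_Rintegral.
have mMC := measurableC mM.
have fMC : \int[mu]_(x in ~` M) `|f x| = 0.
  pose N := ~` M `&` [set x | f x != 0].
  have mN : measurable N.
    apply: measurableI => //; rewrite (_ : mkset _ = setT `&` f @^-1` (~` [set 0])).
      by apply: mf => //; exact: measurableC.
    by rewrite setTI; apply/seteqP; split => x /= /eqP.
  have N0 : mu N = 0.
    apply/eqP; apply: contrapT => /negP muN.
    have Npos : (0 < mu N)%E by rewrite lt0e muN/=.
    have [A AN Aat] := pa N mN Npos; have [mA Apos _] := Aat.
    have gMA := good_U _ _ (conj mM gM) (good_atom A Aat).
    have := Mmax _ gMA (@subsetUl _ M A); have [mMA _] := gMA.
    rewrite (Rintegral_setD mM mMA)//; last exact: integrableS nfi.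
    have -> : (M `|` A) `\` M = A.
      rewrite setDUl setDv set0U; apply/seteqP; split => [x []//|x Ax].
      by split=> //; have [] := AN x Ax.
    rewrite gerDl => A0.
    have {}A0 : \int[mu]_(x in A) `|f x| = 0.
      by apply/eqP; rewrite eq_le A0 Rintegral_ge0.
    have {}A0 : (\int[mu]_(x in A) `|(EFin \o f) x| = 0)%E.
      rewrite -[LHS]fineK; first by congr EFin; exact: A0.
      by apply: integrable_fin_num => //; apply: integrableS nfi.
    have /(ae_eq_integral_abs mu mA) : measurable_fun A (EFin \o f).
      by apply/measurable_EFinP; exact: measurable_funTS.
    case=> /(_ A0) + _ => fA0.
    have /negligibleP : mu.-negligible A.
      apply: negligibleS fA0 => x Ax /= /(_ Ax) [fx0].
      by have [_ /=] := AN x Ax; rewrite fx0 eqxx.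
    by move=> /(_ mA) muA0; rewrite muA0 ltxx in Apos.
  transitivity (\int[mu]_(x in ~` M) (0 : R)); last by rewrite Rintegral_cst// mul0r.
  congr fine; apply: ae_eq_integral => //.
  - by apply/measurable_EFinP; apply: measurable_funTS; exact: measurableT_comp.
  - exists N; split => // x /=; apply: contra_notP => nN Mx.
    have [->|fx] := eqVneq (f x) 0; first by rewrite normr0.
    by exfalso; apply: nN; split.
apply: filterS (gM _ e0) => k Mk kb.
rewrite (Rintegral_setD mM measurableT)//; last exact: wi.
rewrite setTD -[ltRHS]addr0; apply: ltr_leD (Mk kb) _.
by rewrite (le_trans (w_le _ _ _))// fMC mulr0.
Qed.

End atoms.

(** * Lifting a perturbation of a mean *)

Section lift.
Context {R : realType}.
Implicit Types a t s : R.

(** If [t] is the mean of numbers [a] in [-1, 1], moving each [a] towards 1 (or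
    towards -1) by the same proportion of its distance moves the mean to any
    prescribed [s] in [-1, 1]. When [t = 1] the quotient is [0 / 0 = 0], which is
    right since then [s = t]. *)
Definition lift_mean t s a : R :=
  if t <= s then a + (s - t) / (1 - t) * (1 - a)
  else a - (t - s) / (1 + t) * (1 + a).

Lemma lift_mean_le1 t s a : `|t| <= 1 -> `|s| <= 1 -> `|a| <= 1 ->
  `|lift_mean t s a| <= 1.
Proof.
rewrite !ler_norml /lift_mean => /andP[t1 t2] /andP[s1 s2] /andP[a1 a2].
case: (leP t s) => ts.
- have q0 : 0 <= (s - t) / (1 - t) by rewrite divr_ge0 ?subr_ge0.
  have q1 : (s - t) / (1 - t) <= 1.
    have [->|t1n] := eqVneq t 1; first by rewrite subrr invr0 mulr0.
    by rewrite ler_pdivrMr ?mul1r; lra.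
  move: (_ / _) q0 q1 => q q0 q1; apply/andP; split; nra.
- have q0 : 0 <= (t - s) / (1 + t) by rewrite divr_ge0; lra.
  have q1 : (t - s) / (1 + t) <= 1.
    by rewrite ler_pdivrMr ?mul1r; lra.
  move: (_ / _) q0 q1 => q q0 q1; apply/andP; split; nra.
Qed.

Lemma normr_mean_le1 n (lambda a : 'I_n -> R) :
    (forall i, 0 <= lambda i) -> \sum_i lambda i = 1 ->
    (forall i, `|a i| <= 1) -> `|\sum_i lambda i * a i| <= 1.
Proof.
move=> l0 l1 a1; rewrite -l1 (le_trans (ler_norm_sum _ _ _))// ler_sum// => i _.
by rewrite normrM ger0_norm// ler_piMr.
Qed.

Lemma sum_lift_mean n (lambda a : 'I_n -> R) s :
    (forall i, 0 <= lambda i) -> \sum_i lambda i = 1 ->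
    (forall i, `|a i| <= 1) -> `|s| <= 1 ->
  \sum_i lambda i * lift_mean (\sum_j lambda j * a j) s (a i) = s.
Proof.
move=> l0 l1 a1 s1; set t := \sum_j lambda j * a j.
have t1 : `|t| <= 1 by exact: normr_mean_le1.
move: s1 t1; rewrite !ler_norml => /andP[s1 s2] /andP[t1 t2].
rewrite /lift_mean; case: (leP t s) => ts.
- under eq_bigr do rewrite mulrDr mulrCA (mulrBr _ 1) mulr1.
  rewrite big_split/= -mulr_sumr sumrB l1 -/t.
  have [t1e|t1n] := eqVneq t 1; first by rewrite t1e; lra.
  by rewrite divfK; lra.
- under eq_bigr do rewrite mulrBr mulrCA (mulrDr _ 1) mulr1.
  rewrite sumrB/= -mulr_sumr big_split l1 -/t/=.
  by rewrite divfK; lra.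
Qed.

(** The bound does not degenerate when [t] approaches 1 or -1: as one term of a sum
    of nonnegative numbers, [lambda i * (1 - a i)] is at most [1 - t]. *)
Lemma lift_mean_dist n (lambda a : 'I_n -> R) s i :
    (forall i, 0 <= lambda i) -> \sum_i lambda i = 1 ->
    (forall i, `|a i| <= 1) -> `|s| <= 1 ->
  lambda i * `|lift_mean (\sum_j lambda j * a j) s (a i) - a i|
    <= `|s - \sum_j lambda j * a j|.
Proof.
move=> l0 l1 a1 s1; set t := \sum_j lambda j * a j.
have gap (b : 'I_n -> R) : (forall j, 0 <= b j) -> lambda i * b i <= \sum_j lambda j * b j.
  move=> b0; rewrite (bigD1 i)//= lerDl sumr_ge0// => j _.
  by rewrite mulr_ge0.
have up : lambda i * (1 - a i) <= 1 - t.
  apply: le_trans (gap (fun j => 1 - a j) _) _.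
    by move=> j; rewrite subr_ge0 (le_trans (ler_norm _)).
  by under eq_bigr do rewrite mulrBr mulr1; rewrite sumrB l1.
have dn : lambda i * (1 + a i) <= 1 + t.
  apply: le_trans (gap (fun j => 1 + a j) _) _.
    by move=> j; have := a1 j; rewrite ler_norml; lra.
  by under eq_bigr do rewrite mulrDr mulr1; rewrite big_split/= l1.
have := a1 i; move: s1; rewrite !ler_norml => /andP[s1 s2] /andP[ai1 ai2].
have li := l0 i.
rewrite /lift_mean; case: (leP t s) => ts.
- rewrite addrAC subrr add0r [`|s - t|]ger0_norm ?subr_ge0//.
  have t1 : 0 <= 1 - t by lra.
  rewrite ger0_norm; last by rewrite mulr_ge0 ?divr_ge0; lra.
  rewrite mulrCA; have [t0|tn] := eqVneq (1 - t) 0.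
    by rewrite t0 invr0 mulr0 mul0r; lra.
  rewrite mulrAC ler_pdivrMr; last by rewrite lt_def tn.
  by rewrite ler_wpM2l ?subr_ge0.
- rewrite addrAC subrr add0r normrN distrC [`|t - s|]gtr0_norm ?subr_gt0//.
  have t1 : 0 < 1 + t by lra.
  rewrite ger0_norm; last by rewrite mulr_ge0 ?divr_ge0; lra.
  rewrite mulrCA mulrAC ler_pdivrMr//.
  by rewrite ler_wpM2l ?subr_ge0// ltW.
Qed.

Lemma measurable_lift_mean d (T : measurableType d) (t s a : T -> R) :
    measurable_fun setT t -> measurable_fun setT s -> measurable_fun setT a ->
    (forall x, `|t x| <= 1) ->
  measurable_fun setT (fun x => lift_mean (t x) (s x) (a x)).
Proof.
move=> mt ms ma t1.
(* on nonnegative reals the inverse is a power, known to be measurable *)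
have -> : (fun x => lift_mean (t x) (s x) (a x)) = fun x => if t x <= s x then
    a x + (s x - t x) * (1 - t x) `^ (-1) * (1 - a x)
  else a x - (t x - s x) * (1 + t x) `^ (-1) * (1 + a x).
  apply/funext => x; have := t1 x; rewrite ler_norml /lift_mean => /andP[? ?].
  by case: leP => _; rewrite powR_inv1 //; lra.
have mp (u : T -> R) : measurable_fun setT u -> measurable_fun setT (fun x => u x `^ (-1)).
  by move=> mu; exact: (measurableT_comp (measurable_powR (-1)) mu).
apply: measurable_fun_ifT; first exact: measurable_fun_ler.
- apply: measurable_funD => //; apply: measurable_funM; last exact: measurable_funB.
  apply: measurable_funM; first exact: measurable_funB.
  by apply: mp; exact: measurable_funB.
- apply: measurable_funB => //; apply: measurable_funM; last exact: measurable_funD.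
  apply: measurable_funM; first exact: measurable_funB.
  by apply: mp; exact: measurable_funD.
Qed.

End lift.

(** * Purely atomic measures have (W*1) *)

Section purely_atomic_open.
Context d (T : measurableType d) (R : realType) (mu : {measure set T -> \bar R}).

Lemma ball_convex_combination n (lambda : 'I_n -> R) (g : 'I_n -> Linfty mu) (h : Linfty mu) :
    (forall i, 0 <= lambda i) -> \sum_i lambda i = 1 ->
    (forall i, Linfty_ball (g i)) ->
    (h : T -> R) = (fun x => \sum_(i < n) lambda i * g i x) %[ae mu] ->
  (h : T -> R) = (fun x => \sum_(i < n) lambda i * clip (g i) x) %[ae mu] /\ Linfty_ball h.
Proof.
move=> l0 l1 gb hg.
have hc : (h : T -> R) = (fun x => \sum_(i < n) lambda i * clip (g i) x) %[ae mu].
  have gc : \forall x \ae mu, forall i, g i x = clip (g i) x.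
    by apply: filter_forall => i; apply: filterS (ball_clip (gb i)) => x /(_ I).
  apply: filterS2 hg gc => x hx gx _; rewrite hx//.
  by apply: eq_bigr => i _; rewrite gx.
split => //; apply/ballP.
apply: filterS hc => x /(_ I) ->.
by apply: normr_mean_le1 => // i; exact: clip_le1.
Qed.

Lemma subset_convex_combination_ball (C : set (Linfty mu)) :
  convex_combination_of_slices C -> C `<=` @Linfty_ball d T R mu.
Proof.
move=> [n [lambda [S [l0 l1 Ss ->]]]] h [g Sg hg].
have l0' i : 0 <= lambda i by case/andP: (l0 i).
have gb i : Linfty_ball (g i).
  by have [f [a [_ _ SE]]] := Ss i; have := Sg i; rewrite SE => -[].
by have [] := ball_convex_combination l0' l1 gb hg.
Qed.

Lemma purely_atomic_Wstar1 : purely_atomic mu -> property_Wstar1 mu.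
Proof.
move=> pa C CC; have Cb := subset_convex_combination_ball CC.
move: CC => [n [lambda [S [l0 l1 Ss CE]]]].
have {}l0 i : 0 <= lambda i by case/andP: (l0 i).
rewrite openE => h Ch; have hb := Cb _ Ch.
suff : within (@Linfty_ball d T R mu : set (weak_star mu)) (nbhs (h : weak_star mu)) C.
  by rewrite nbhs_subspace_in.
move: Ch; rewrite {1}CE => -[g Sg hg].
have [F FE] := choice Ss; have [al {}FE] := choice FE.
have gb i : Linfty_ball (g i) by have := Sg i; have [_ _ ->] := FE i => -[].
have gF i : 1 - al i < duality (g i) (F i).
  by have := Sg i; have [_ _ ->] := FE i => -[].
have [hc _] := ball_convex_combination l0 l1 gb hg.
(* [g i] misses the boundary of its slice by the numerator of [e i]; the
   denominator absorbs the factor [(lambda i)^-1] of [w_dist], with an added 1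
   since this factor is 0 when [lambda i = 0] *)
pose e i := (duality (g i) (F i) - (1 - al i)) / (1 + (lambda i)^-1).
have inv0 i : 0 <= (lambda i)^-1 by rewrite invr_ge0.
have e0 i : 0 < e i by rewrite divr_gt0 ?subr_gt0// ltr_wpDr.
have near_h : \forall k \near (h : weak_star mu), forall i, Linfty_ball k ->
    \int[mu]_x (`|F i x| * `|clip k x - clip h x|) < e i.
  apply: (@filter_forall _ _ _ (nbhs (h : weak_star mu))) => i.
  by apply: purely_atomic_near => //; exact: L1_integrable.
apply: filterS near_h => k near_k kb; rewrite CE.
pose a i x := clip (g i) x.
pose t x := \sum_i lambda i * a i x.
(* a term of weight 0 has no influence on the mean and is left unchanged *)
pose w i x := if lambda i == 0 then a i x else lift_mean (t x) (clip k x) (a i x).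
have ma i : measurable_fun setT (a i) by apply: measurable_clip; exact: Linfty_measurable.
have mt : measurable_fun setT t.
  by apply: measurable_sum => i; apply: measurable_funM.
have mk : measurable_fun setT (clip k) by apply: measurable_clip; exact: Linfty_measurable.
have mh : measurable_fun setT (clip h) by apply: measurable_clip; exact: Linfty_measurable.
have t1 x : `|t x| <= 1 by apply: normr_mean_le1 => // i; exact: clip_le1.
have mw i : measurable_fun setT (w i).
  by rewrite /w; case: eqP => // _; apply: measurable_lift_mean.
have w1 i x : `|w i x| <= 1.
  by rewrite /w; case: eqP => // _; [|apply: lift_mean_le1]; rewrite ?clip_le1.
have w_dist i x : `|w i x - a i x| <= (lambda i)^-1 * `|clip k x - t x|.
  rewrite /w; have [->|li] := eqVneq (lambda i) 0; first by rewrite subrr normr0 invr0 mul0r.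
  rewrite ler_pdivlMl; last by rewrite lt_def li l0.
  by apply: (@lift_mean_dist _ _ lambda (fun j => a j x)) => // *; exact: clip_le1.
have [g' g'b g'w] : exists2 g' : 'I_n -> Linfty mu, (forall i, Linfty_ball (g' i)) &
    forall i, (g' i : T -> R) = w i %[ae mu].
  have /choice[g' g'P] : forall i, exists g' : Linfty mu,
      Linfty_ball g' /\ (g' : T -> R) = w i %[ae mu].
    by move=> i; have [g' ? ?] := Linfty_class mu (mw i) (w1 i); exists g'.
  by exists g' => i; case: (g'P i).
exists g'; last first.
  have g'w' : \forall x \ae mu, forall i, g' i x = w i x.
    by apply: filter_forall => i; apply: filterS (g'w i) => x /(_ I).
  apply: filterS2 (ball_clip kb) g'w' => x kx gx _; rewrite kx//.
  under eq_bigr do rewrite gx.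
  transitivity (\sum_i lambda i * lift_mean (t x) (clip k x) (a i x)).
    by rewrite sum_lift_mean// => *; exact: clip_le1.
  by apply: eq_bigr => i _; rewrite /w; case: eqP => // ->; rewrite !mul0r.
move=> i; have [_ al0 ->] := FE i; split => //.
have mF := L1_measurable (F i); have iF := L1_integrable (F i).
have dg : duality (g i) (F i) = \int[mu]_x (F i x * a i x).
  by apply: dualityE => //; exact: ae_eq_refl.
have dg' : duality (g' i) (F i) = \int[mu]_x (F i x * w i x).
  apply: ae_eq_Rintegral => //.
  - by apply: measurable_funM => //; exact: Linfty_measurable.
  - by apply: measurable_funM.
  - by apply: filterS (g'w i) => x gx _; rewrite gx.
have ia : mu.-integrable setT (EFin \o (fun x => F i x * a i x)).
  by apply: (@integrable_bounded _ _ _ mu _ _ 1) => // x; exact: clip_le1.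
have iw : mu.-integrable setT (EFin \o (fun x => F i x * w i x)).
  by apply: (@integrable_bounded _ _ _ mu _ _ 1).
have icl : mu.-integrable setT (EFin \o (fun x => `|F i x| * `|clip k x - clip h x|)).
  apply: (@integrable_bounded _ _ _ mu _ _ 2) => //.
  - exact: integrable_abse iF.
  - by apply: measurableT_comp => //; exact: measurable_funB.
  - by move=> x; rewrite normr_id (le_trans (ler_normB _ _))// (_ : 2 = 1 + 1)// lerD// clip_le1.
have icl' : mu.-integrable setT (EFin \o (fun x => `|F i x| * `|clip k x - t x|)).
  apply: (@integrable_bounded _ _ _ mu _ _ 2) => //.
  - exact: integrable_abse iF.
  - by apply: measurableT_comp => //; exact: measurable_funB.
  - by move=> x; rewrite normr_id (le_trans (ler_normB _ _))// (_ : 2 = 1 + 1)// lerD// clip_le1.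
have : `|duality (g' i) (F i) - duality (g i) (F i)| <= (lambda i)^-1 * e i.
  rewrite dg dg' -RintegralB// (le_trans (le_normr_Rintegral _ _))//.
    exact: (integrableB measurableT iw ia).
  apply: (@le_trans _ _ ((lambda i)^-1 * \int[mu]_x (`|F i x| * `|clip k x - clip h x|))); last first.
    by rewrite ler_wpM2l// ltW// near_k.
  rewrite -[X in _ * X](@ae_eq_Rintegral _ _ _ _ _ (fun x => `|F i x| * `|clip k x - t x|))//; first last.
  - apply: filterS2 hc (ball_clip hb) => x h1 h2 _; rewrite -h2// h1//.
  - by apply: measurable_funM; [apply: measurableT_comp|apply: measurableT_comp => //; exact: measurable_funB].
  - by apply: measurable_funM; [apply: measurableT_comp|apply: measurableT_comp => //; exact: measurable_funB].
  rewrite -RintegralZl//; apply: le_Rintegral => //.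
  - exact: (integrable_abse (integrableB measurableT iw ia)).
  - exact: (integrableZl measurableT _ icl').
  - move=> x _; rewrite -mulrBr normrM mulrCA; exact: ler_wpM2l.
move: (gF i); have := inv0 i.
have : e i * (1 + (lambda i)^-1) = duality (g i) (F i) - (1 - al i).
  by rewrite /e divfK// gt_eqF// ltr_wpDr.
have := e0 i; rewrite ler_norml.
set x := duality _ _; set y := duality _ _; set z := (_)^-1.
move=> ep E z0 gt /andP[lo hi].
nra.
Qed.

End purely_atomic_open.

(** * Sierpinski's theorem *)

Section atomless.
Context d (T : measurableType d) (R : realType) (mu : {measure set T -> \bar R}).
Variable B : set T.
Hypotheses (mB : measurable B) (Boo : (mu B < +oo)%E).
Hypothesis Batomless : forall A, A `<=` B -> ~ atom mu A.

Let m A : R := fine (mu A).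

Let mE A : measurable A -> A `<=` B -> mu A = (m A)%:E.
Proof.
move=> mA AB; rewrite /m fineK// ge0_fin_numE//.
by apply: le_lt_trans Boo; apply: le_measure; rewrite ?inE.
Qed.

Let mD A C : measurable A -> measurable C -> A `<=` C -> C `<=` B ->
  m C = m A + m (C `\` A).
Proof.
move=> mA mC AC CB; apply: EFin_inj; rewrite EFinD -!mE//; last 3 first.
- exact: measurableD.
- by move=> x [/CB].
- exact: subset_trans CB.
rewrite -measureU ?setDUK//; first exact: measurableD.
by rewrite setDE setICA setICr setI0.
Qed.

(** A set that is not an atom splits into two parts of positive measure, one of
    which has at most half of the measure; this is iterated. *)
Lemma atomless_small_subset A (e : R) : measurable A -> A `<=` B -> (0 < mu A)%E ->
  0 < e -> exists2 E, measurable E & [/\ E `<=` A, (0 < mu E)%E & (mu E <= e%:E)%E].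
Proof.
move=> mA AB A0 e0.
have small n : exists2 E, measurable E & [/\ E `<=` A, (0 < mu E)%E & m E * n.+1%:R <= m A].
  elim: n => [|n [E mE' [EA E0 En]]]; first by exists A => //; split; rewrite ?mulr1.
  have EB := subset_trans EA AB.
  have [C [mC CE C0 EC0]] : exists C, [/\ measurable C, C `<=` E, mu C <> 0%E & mu (E `\` C) <> 0%E].
    apply: contrapT => nC; apply: (Batomless EB); split=> // C mC CE.
    have [C0|/eqP C0] := eqVneq (mu C) 0%E; [by left|right].
    by apply: contrapT => EC0; apply: nC; exists C.
  have half F : measurable F -> F `<=` E -> mu F <> 0%E -> m F <= m E / 2 ->
      exists2 F, measurable F & [/\ F `<=` A, (0 < mu F)%E & m F * n.+2%:R <= m A].
    move=> mF FE F0 Fh; exists F => //; split; first exact: subset_trans EA.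
      by rewrite lt0e measure_ge0 andbT; apply/eqP.
    apply: le_trans En; rewrite (le_trans (ler_wpM2r _ Fh))//.
    have n0 : 0 <= n%:R :> R by [].
    have mE0 : 0 <= m E by exact: fine_ge0.
    by rewrite -(natr1 n.+1) -(natr1 n); have := mulr_ge0 mE0 n0; lra.
  have mEC := measurableD mE' mC; have ECE : E `\` C `<=` E by move=> x [].
  have := mD mC mE' CE EB.
  have [Ch _|Ch E2] := leP (m C) (m E / 2); first exact: half Ch.
  by apply: (half (E `\` C)) => //; lra.
pose n := Num.bound (m A / e).
have [E mE' [EA E0 En]] := small n; exists E => //; split => //.
rewrite (mE mE' (subset_trans EA AB)) lee_fin leNgt; apply/negP => eE.
have : m A / e < n%:R by rewrite archi_boundP// divr_ge0 ?fine_ge0// ltW.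
rewrite ltr_pdivrMr// ltNge => /negP; apply; apply: le_trans En.
rewrite mulrC; apply: ler_pM => //; first exact: ltW.
  exact: ltW.
by rewrite ler_nat.
Qed.

(** A maximal subset of measure at most [c] has measure [c], as otherwise a small
    subset of positive measure could be added to it. *)
Lemma atomless_intermediate_value A (c : R) : measurable A -> A `<=` B ->
  0 <= c -> (c%:E <= mu A)%E -> exists2 D, measurable D & D `<=` A /\ mu D = c%:E.
Proof.
move=> mA AB c0 cA.
pose P D := [/\ measurable D, D `<=` A & m D <= c].
have [||||M [mM MA Mc] Mmax] := @exhaustion T R P m c set0.
- by split; rewrite /m ?measure0.
- move=> D PD DS; have mDn n : measurable (D n) by case: (PD n).
  have UA : \bigcup_n D n `<=` A by move=> x [n _ Dx]; have [_ + _] := PD n; exact.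
  have mU : measurable (\bigcup_n D n) by exact: bigcupT_measurable.
  split=> //; rewrite -lee_fin -(mE mU (subset_trans UA AB)).
  have ndD : nondecreasing_seq D.
    by apply/nondecreasing_seqP => n; apply/subsetPset; exact: DS.
  have cv := nondecreasing_cvg_mu (mu := mu) mDn mU ndD.
  rewrite -(cvg_lim _ cv)//; apply: lime_le; first by apply/cvg_ex; exists (mu (\bigcup_n D n)).
  apply: nearW => n /=; have [_ DA Dc] := PD n.
  by rewrite (mE (mDn n) (subset_trans DA AB)) lee_fin.
- move=> D E [mD' DA _] [mE' EA _] DE.
  by rewrite (mD mD' mE' DE (subset_trans EA AB)) lerDl fine_ge0.
- by move=> D [].
have MB := subset_trans MA AB.
exists M => //; split => //; rewrite (mE mM MB); congr EFin; apply/eqP.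
rewrite eq_le Mc/= leNgt; apply/negP => Mltc.
have mAM := measurableD mA mM; have AMB : A `\` M `<=` B by move=> x [/AB].
have AM0 : (0 < mu (A `\` M))%E.
  rewrite mE// lte_fin; have := mD mM mA MA AB.
  move: cA; rewrite mE// lee_fin; lra.
have cM : 0 < c - m M by rewrite subr_gt0.
have [E mE' [EAM E0 Ec]] := atomless_small_subset mAM AMB AM0 cM.
have EB := subset_trans EAM AMB.
have mME := measurableU _ _ mM mE'.
have MEA : M `|` E `<=` A by move=> x [/MA//|/EAM[]].
have mUE : m (M `|` E) = m M + m E.
  rewrite (mD mM mME (@subsetUl _ _ _) (subset_trans MEA AB)); congr (_ + m _).
  rewrite setDUl setDv set0U; apply/seteqP; split => [x []//|x Ex].
  by split=> //; have [] := EAM x Ex.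
move: E0 Ec; rewrite (mE mE' EB) lte_fin lee_fin => E0 Ec.
have := Mmax (M `|` E) _ (@subsetUl _ _ _).
rewrite mUE gerDl => H; have : m E <= 0.
  by apply: H; split => //; rewrite mUE; lra.
by rewrite leNgt E0.
Qed.

End atomless.

(** * Unimodular functions on an atomless set *)

Import HBSimple.

Section balance.
Context d (T : measurableType d) (R : realType) (mu : {measure set T -> \bar R}).

Lemma integrable_indic_lty A : measurable A -> (mu A < +oo)%E ->
  mu.-integrable setT (EFin \o (\1_A : T -> R)).
Proof.
move=> mA Aoo; apply/integrableP; split; first exact/measurable_EFinP.
under eq_integral do rewrite /= ger0_norm//.
by rewrite integral_indic// setIT.
Qed.

Definition pm1 (D : set T) (x : T) : R := 2 * \1_D x - 1.

Lemma pm1_in (D : set T) x : D x -> pm1 D x = 1.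
Proof. by move=> Dx; rewrite /pm1 indicE mem_set//=; lra. Qed.

Lemma pm1_out (D : set T) x : ~ D x -> pm1 D x = -1.
Proof. by move=> Dx; rewrite /pm1 indicE memNset//=; lra. Qed.

Lemma normr_pm1 D x : `|pm1 D x| = 1.
Proof.
by have [/pm1_in ->|/pm1_out ->] := pselect (D x); rewrite ?normrN normr1.
Qed.

Lemma measurable_pm1 D : measurable D -> measurable_fun setT (pm1 D).
Proof.
move=> mD; apply: measurable_funB => //; apply: measurable_funM => //.
Qed.

Variables (B : set T) (u : T -> R).
Hypotheses (mB : measurable B) (Boo : (mu B < +oo)%E).
Hypothesis Batomless : forall A, A `<=` B -> ~ atom mu A.
Hypotheses (mfu : measurable_fun setT u) (u1 : forall x, `|u x| <= 1).

(** The change of the integral against [f] when [u] is replaced on [E] by the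
    function with value 1 on [D] and -1 elsewhere. *)
Definition steer (E D : set T) (f : T -> R) : R :=
  \int[mu]_(x in E) (f x * (pm1 D x - u x)).

Let diff_le2 D x : `|pm1 D x - u x| <= 2.
Proof.
by rewrite (le_trans (ler_normB _ _))// normr_pm1 (_ : 2 = 1 + 1)// lerD.
Qed.

Let diff_meas D : measurable D -> measurable_fun setT (fun x => pm1 D x - u x).
Proof. by move=> mD; apply: measurable_funB => //; exact: measurable_pm1. Qed.

Let steer_integrable E D f : measurable E -> measurable D ->
  mu.-integrable setT (EFin \o f) ->
  mu.-integrable E (EFin \o (fun x => f x * (pm1 D x - u x))).
Proof.
move=> mE mD fi; apply: (@integrable_bounded _ _ _ mu _ _ 2) => //.
exact: diff_meas.
Qed.

Lemma steerU E1 E2 D1 D2 f : measurable E1 -> measurable E2 -> measurable D1 -> measurable D2 ->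
    D1 `<=` E1 -> D2 `<=` E2 -> E1 `&` E2 = set0 -> mu.-integrable setT (EFin \o f) ->
  steer (E1 `|` E2) (D1 `|` D2) f = steer E1 D1 f + steer E2 D2 f.
Proof.
move=> mE1 mE2 mD1 mD2 DE1 DE2 E12 fi; rewrite /steer Rintegral_setU//.
- have E12' x : E1 x -> E2 x -> False by move=> ? ?; have : set0 x by rewrite -E12.
  congr (_ + _); apply: eq_Rintegral => x /set_mem Ex; congr (_ * (_ - _)).
  + have [Dx|Dx] := pselect (D1 x); first by rewrite !pm1_in//; left.
    by rewrite !pm1_out// => -[//|/DE2]; exact: E12'.
  + have [Dx|Dx] := pselect (D2 x); first by rewrite !pm1_in//; right.
    by rewrite !pm1_out// => -[/DE1 /E12'|//]; apply.
- by apply: steer_integrable => //; exact: measurableU.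
- by apply/disj_setPS; rewrite E12.
Qed.

Lemma steer_le E D f : measurable E -> measurable D -> mu.-integrable setT (EFin \o f) ->
  `|steer E D f| <= 2 * \int[mu]_x `|f x|.
Proof.
move=> mE mD fi; have nfi : mu.-integrable setT (EFin \o (fun x => `|f x|)).
  exact: integrable_abse fi.
have si := steer_integrable mE mD fi.
apply: le_trans (le_normr_Rintegral mE si) _.
apply: (@le_trans _ _ (2 * \int[mu]_(x in E) `|f x|)); last first.
  by rewrite ler_wpM2l//; exact: subset_Rintegral.
have nfE := integrableS measurableT mE (@subsetT _ _) nfi.
rewrite -RintegralZl//; apply: le_Rintegral => //.
- exact: integrable_abse si.
- exact: (integrableZl mE 2 nfE).
- by move=> x _; rewrite normrM mulrC ler_wpM2r.
Qed.

Let indicB_integrable : mu.-integrable setT (EFin \o (\1_B : T -> R)).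
Proof. exact: integrable_indic_lty. Qed.

(** The function with values 1 on [D] and -1 on [E `\` D] has integral
    [2 mu(D) - mu(E)] over [E]. By Sierpinski's theorem [D] can be chosen so that
    this is the integral of [u], which lies between [- mu(E)] and [mu(E)]. *)
Lemma steer_indic_exact E : measurable E -> E `<=` B ->
  exists D, [/\ measurable D, D `<=` E & steer E D \1_B = 0].
Proof.
move=> mE EB.
have Efin : mu E \is a fin_num.
  by rewrite ge0_fin_numE//; apply: le_lt_trans Boo; apply: le_measure; rewrite ?inE.
pose c := \int[mu]_(x in E) (\1_B x * u x).
have iu : mu.-integrable E (EFin \o (fun x => \1_B x * u x)).
  exact: (@integrable_bounded _ _ _ mu _ _ 1).
have Eoo : (mu E < +oo)%E by rewrite -ge0_fin_numE.
have i1 (r : R) : mu.-integrable E (EFin \o (fun=> r)).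
  have iE := integrableS measurableT mE (@subsetT _ _) (integrable_indic_lty mE Eoo).
  move: (integrableZl mE r iE); apply: eq_integrable => // x Ex /=.
  by rewrite indicE Ex mule1.
have c_le : `|c| <= fine (mu E).
  rewrite (le_trans (le_normr_Rintegral mE iu))//.
  rewrite -[leRHS]mul1r -Rintegral_cst//; apply: le_Rintegral => //.
    exact: integrable_abse iu.
  move=> x Ex; rewrite indicE mem_set ?mul1r//; exact: EB.
pose b := (c + fine (mu E)) / 2.
have b0 : 0 <= b by move: c_le; rewrite ler_norml /b; lra.
have bE : (b%:E <= mu E)%E.
  by rewrite -(fineK Efin) lee_fin; move: c_le; rewrite ler_norml /b; lra.
have [D mD [DE Db]] := atomless_intermediate_value mB Boo Batomless mE EB b0 bE.
exists D; split => //.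
rewrite /steer; under eq_Rintegral do rewrite mulrBr.
rewrite RintegralB//; last first.
  by apply: (@integrable_bounded _ _ _ mu _ _ 1) => // [|x]; [exact: measurable_pm1|rewrite normr_pm1].
rewrite -/c.
have iD : mu.-integrable E (EFin \o (\1_D : T -> R)).
  apply: (integrableS measurableT) => //; apply: integrable_indic_lty => //.
  by rewrite Db ltry.
have -> : \int[mu]_(x in E) (\1_B x * pm1 D x) = \int[mu]_(x in E) (2 * \1_D x - 1).
  by apply: eq_Rintegral => x /set_mem /EB Bx; rewrite indicE mem_set// mul1r.
rewrite RintegralB//; last exact: (integrableZl mE 2 iD).
rewrite RintegralZl// Rintegral_cst// mul1r.
have -> : \int[mu]_(x in E) \1_D x = b.
  by rewrite /Rintegral integral_indic// (setIidl DE) Db.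
rewrite /b; lra.
Qed.

(** Induction on the list of test functions. A new test function [f] is replaced
    by a nearby simple function [s], and the induction hypothesis is applied on
    each level set of [s]. Since it also makes [steer] vanish exactly at the
    constant 1 there, it makes [steer] vanish at [s]. This is the reason for
    carrying the exact condition at [\1_B] through the induction. *)
Lemma steer_approx (fs : seq (L1 mu)) E (e : R) : measurable E -> E `<=` B -> 0 < e ->
  exists D, [/\ measurable D, D `<=` E, steer E D \1_B = 0 &
    forall f : L1 mu, f \in fs -> `|steer E D f| <= e].
Proof.
elim: fs E e => [|f fs IH] E e mE EB e0.
  by have [D [mD DE D0]] := steer_indic_exact mE EB; exists D; split.
have fi := L1_integrable f.
have [s_ [s_i _ s_cvg]] := approximation_sfun_integrable measurableT fi.
have [s si s_e] : exists2 s : {sfun T >-> R}, mu.-integrable setT (EFin \o s) &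
    \int[mu]_x `|f x - s x| <= e / 2.
  have e2 : 0 < e / 2 by rewrite divr_gt0.
  move/fine_cvgP : s_cvg => [_ /cvgrPdist_lt /(_ _ e2)] [n _ /(_ n (leqnn n))].
  rewrite /= sub0r normrN => /ltW sn; exists (s_ n) => //.
  exact: le_trans (ler_norm _) sn.
have /finite_seqP[vs vsE] := @fimfunP _ _ s.
have level (ws : seq R) e' : 0 < e' ->
    exists D, [/\ measurable D, D `<=` E `&` s @^-1` [set` ws],
      steer (E `&` s @^-1` [set` ws]) D \1_B = 0,
      steer (E `&` s @^-1` [set` ws]) D s = 0 &
      forall g : L1 mu, g \in fs -> `|steer (E `&` s @^-1` [set` ws]) D g| <= e'].
  elim: ws e' => [|v ws IHws] e' e'0.
    have -> : E `&` s @^-1` [set` ([::] : seq R)] = set0.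
      by apply/seteqP; split => // x [_].
    exists set0; rewrite /steer !Rintegral_set0; split => // g _.
    by rewrite Rintegral_set0 normr0 ltW.
  have e'2 : 0 < e' / 2 by rewrite divr_gt0.
  have [D1] := IHws _ e'2; set E1 := E `&` _ => -[mD1 D1E D1B D1s D1fs].
  have mpre (A : set R) : measurable A -> measurable (s @^-1` A).
    by move=> mA; rewrite -[X in measurable X]setTI; exact: measurable_funPT.
  have mws : measurable [set` ws].
    by apply: countable_measurable => //; apply: finite_set_countable; exact: finite_seq.
  have mE1 : measurable E1 by apply: measurableI => //; exact: mpre.
  pose E2 := (E `&` s @^-1` [set v]) `\` E1.
  have mE2 : measurable E2 by apply: measurableD => //; apply: measurableI => //; exact: mpre.
  have E2B : E2 `<=` B by move=> x [[/EB]].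
  have [D2 [mD2 D2E D2B D2fs]] := IH _ _ mE2 E2B e'2.
  have -> : E `&` s @^-1` [set` v :: ws] = E1 `|` E2.
    apply/seteqP; split => x /=.
      move=> [Ex]; rewrite inE => /orP[/eqP sv|sx]; last by left.
      by have [E1x|nE1] := pselect (E1 x); [left|right].
    by move=> [[Ex sx]|[[Ex ->] _]]; rewrite inE ?eqxx//; split=> //; apply/orP; right.
  have E12 : E1 `&` E2 = set0 by rewrite /E2 setDE setICA setICr setI0.
  have mD := measurableU _ _ mD1 mD2.
  exists (D1 `|` D2); split => //.
  - by apply: setUSS.
  - by rewrite steerU// D1B D2B addr0.
  - rewrite steerU// D1s add0r -[RHS](mulr0 v) -D2B -RintegralZl//; last exact: steer_integrable.
    apply: eq_Rintegral => x /set_mem E2x; rewrite indicE mem_set ?mul1r; last exact: E2B.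
    by case: E2x => -[_ /= ->].
  - move=> g gfs; rewrite steerU//; last exact: L1_integrable.
    by rewrite (le_trans (ler_normD _ _))// [leRHS]splitr lerD// ?D1fs ?D2fs.
have [D [mD DE D0 Ds Dfs]] := level vs e e0.
have sE : E `&` s @^-1` [set` vs] = E.
  apply/setIidPl => x _; suff : range s (s x) by rewrite vsE.
  by exists x.
rewrite sE in DE D0 Ds Dfs; exists D; split => // g.
rewrite inE => /orP[/eqP ->|]; last exact: Dfs.
have fsi : mu.-integrable setT (EFin \o (fun x => f x - s x)).
  exact: (integrableB measurableT fi si).
have -> : steer E D f = steer E D (fun x => f x - s x).
  rewrite -[LHS]subr0 -Ds /steer -RintegralB//; [|exact: steer_integrable..].
  by apply: eq_Rintegral => x _; rewrite mulrBl.
by rewrite (le_trans (steer_le _ _ _))//; lra.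
Qed.

End balance.

(** * The equivalence *)

Section conclusion.
Context d (T : measurableType d) (R : realType) (mu : {measure set T -> \bar R}).

(** The sign of [f] belongs to every slice defined by [f]. *)
Lemma weak_star_slice_nonempty (S : set (Linfty mu)) : weak_star_slice S -> S !=set0.
Proof.
move=> [f [al [f1 al0 ->]]].
pose s := pm1 R [set x | 0 <= f x].
have mf := L1_measurable f.
have ms : measurable_fun setT s.
  apply: measurable_pm1; rewrite -[X in measurable X]setTI.
  rewrite (_ : _ `&` _ = setT `&` f @^-1` `[0, +oo[%classic); first exact: mf.
  by apply/seteqP; split => x /=; rewrite in_itv/= andbT.
have s1 x : `|s x| <= 1 by rewrite normr_pm1.
have [g gb gs] := Linfty_class mu ms s1.
exists g; split=> //.
have -> : duality g f = \int[mu]_x `|f x|.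
  apply: ae_eq_Rintegral => //.
  - by apply: measurable_funM => //; exact: Linfty_measurable.
  - exact: measurableT_comp.
  apply: filterS gs => x /[apply] ->; rewrite /s.
  have [fx|fx] := leP 0 (f x); first by rewrite pm1_in// mulr1 ger0_norm.
  by rewrite pm1_out ?mulrN1 ?ltr0_norm//= leNgt fx.
have -> : \int[mu]_x `|f x| = 1.
  by move: f1; rewrite /L1_sphere/= Lnorm1 /Rintegral => ->.
by rewrite ltrBlDr ltrDl.
Qed.

Lemma Wstar1_Wstar2 : property_Wstar1 mu -> property_Wstar2 mu.
Proof.
move=> W1 C CC; have : C !=set0.
  have [n [lambda [S [l0 l1 Ss ->]]]] := CC.
  have /choice[g Sg] := fun i => weak_star_slice_nonempty (Ss i).
  have mg i : measurable_fun setT (clip (g i)).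
    by apply: measurable_clip; exact: Linfty_measurable.
  have mh : measurable_fun setT (fun x => \sum_(i < n) lambda i * clip (g i) x).
    by apply: measurable_sum => i; exact: measurable_funM.
  have h1 x : `|\sum_(i < n) lambda i * clip (g i) x| <= 1.
    apply: normr_mean_le1 => // i; first by case/andP: (l0 i).
    exact: clip_le1.
  have [h hb hh] := Linfty_class mu mh h1.
  exists h, g => //.
  have gc : \forall x \ae mu, forall i, g i x = clip (g i) x.
    apply: filter_forall => i; have gb : Linfty_ball (g i).
      by have [f [a [_ _ SE]]] := Ss i; have := Sg i; rewrite SE => -[].
    by apply: filterS (ball_clip gb) => x /(_ I).
  apply: filterS2 hh gc => x hx gx _; rewrite hx//.
  by apply: eq_bigr => i _; rewrite gx.
move=> [h Ch]; exists h; have := W1 C CC.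
by rewrite openE; apply.
Qed.

(** The element [k] is [pm1 D] on [B] and [h] off [B], for the set [D] given by
    [steer_approx]. *)
Lemma atomless_dense_unimodular (B : set T) (h : Linfty mu) (fs : seq (L1 mu)) (e : R) :
    measurable B -> (mu B < +oo)%E -> (forall A, A `<=` B -> ~ atom mu A) ->
    Linfty_ball h -> 0 < e ->
  exists k : Linfty mu, [/\ Linfty_ball k, {ae mu, forall x, B x -> `|k x| = 1} &
    forall f, f \in fs -> `|duality k f - duality h f| <= e].
Proof.
move=> mB Boo Bna hb e0.
have mh : measurable_fun setT (clip h) by apply: measurable_clip; exact: Linfty_measurable.
have [D [mD DB _ Dfs]] := steer_approx mB Boo Bna mh (clip_le1 h) fs mB (@subset_refl _ B) e0.
pose v x := if x \in B then pm1 R D x else clip h x.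
have mv : measurable_fun setT v.
  apply: measurable_fun_ifT => //; last exact: measurable_pm1.
  apply: (measurable_fun_bool true) => //; rewrite setTI.
  by rewrite (_ : _ @^-1` _ = B)//; apply/seteqP; split => x /=; [exact: set_mem|exact: mem_set].
have v1 x : `|v x| <= 1 by rewrite /v; case: ifP => _; rewrite ?clip_le1// normr_pm1.
have [k kb kv] := Linfty_class mu mv v1.
exists k; split=> //.
  by apply: filterS kv => x /(_ I) -> Bx; rewrite /v mem_set// normr_pm1.
move=> f ffs; apply: le_trans (Dfs f ffs).
have mf := L1_measurable f; have fi := L1_integrable f.
have -> : duality k f = \int[mu]_x (f x * v x).
  apply: ae_eq_Rintegral => //.
  - by apply: measurable_funM => //; exact: Linfty_measurable.
  - by apply: measurable_funM.
  - by apply: filterS kv => x kx _; rewrite kx.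
have -> : duality h f = \int[mu]_x (f x * clip h x).
  by apply: dualityE => //; exact: ae_eq_refl.
rewrite -RintegralB//; last 2 first.
- exact: (@integrable_bounded _ _ _ mu _ _ 1).
- by apply: (@integrable_bounded _ _ _ mu _ _ 1) => //; exact: clip_le1.
rewrite /steer [X in _ <= `|X|]Rintegral_mkcond le_eqVlt; apply/orP; left; apply/eqP; congr `| _ |.
apply: eq_Rintegral => x _; rewrite /patch /v.
by case: ifP => _; rewrite ?mulrBr// subrr.
Qed.

(** The slices defined by [f = \1_B / mu(B)] and by [- f], with [alpha = 1], are
    disjoint; a function in their average with absolute value 1 on [B] would have
    both its terms equal to it on [B]. *)
Lemma Wstar2_purely_atomic : semifinite_measure mu -> property_Wstar2 mu -> purely_atomic mu.
Proof.
move=> sf W2 A mA A0; apply: contrapT => nA.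
have Ana E : E `<=` A -> ~ atom mu E by move=> EA Eat; apply: nA; exists E.
have [B [mB BA B0 Boo]] : exists B, [/\ measurable B, B `<=` A, (0 < mu B)%E & (mu B < +oo)%E].
  have [Aoo|Aoo] := eqVneq (mu A) +oo%E; last by exists A; split=> //; rewrite lt_neqAle Aoo leey.
  by have [B [mB BA /andP[B0 Boo]]] := sf A mA Aoo; exists B.
have Bna E : E `<=` B -> ~ atom mu E by move=> EB; apply: Ana; exact: subset_trans BA.
pose m := fine (mu B).
have m0 : 0 < m by rewrite fine_gt0// B0.
have muB : mu B = m%:E by rewrite /m fineK// ge0_fin_numE.
pose b x : R := m^-1 * \1_B x.
have ib : mu.-integrable setT (EFin \o b).
  exact: (integrableZl measurableT m^-1 (integrable_indic_lty mB Boo)).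
have iNb : mu.-integrable setT (EFin \o (fun x => - b x)).
  exact: (integrableN ib).
have mb : measurable_fun setT b by exact/measurable_EFinP/(measurable_int mu).
have mNb : measurable_fun setT (fun x => - b x) by exact/measurable_EFinP/(measurable_int mu).
have nb : (\int[mu]_x `|(b x)%:E| = 1)%E.
  rewrite (eq_integral (fun x => (m^-1)%:E * (\1_B x)%:E)%E); last first.
    by move=> x _; rewrite -EFinM abse_EFin ger0_norm// mulr_ge0// invr_ge0 ltW.
  rewrite integralZl//; last exact: integrable_indic_lty.
  by rewrite integral_indic// setIT muB -EFinM mulVf// gt_eqF.
have [F Fb] := L1_class ib; have [F' Fb'] := L1_class iNb.
have sphere (G : L1 mu) (c : T -> R) : measurable_fun setT c -> (G : T -> R) = c %[ae mu] ->
    (\int[mu]_x `|(c x)%:E| = 1)%E -> L1_sphere G.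
  move=> mc Gc c1; rewrite /L1_sphere/= Lnorm1; apply: etrans c1.
  apply: ae_eq_integral => //.
  - apply/measurableT_comp => //; apply/measurable_EFinP; exact: L1_measurable.
  - by apply/measurableT_comp => //; apply/measurable_EFinP.
  - by apply: filterS Gc => x /= /[apply] ->.
have SF : L1_sphere F by exact: sphere Fb nb.
have SF' : L1_sphere F'.
  by apply: sphere mNb Fb' _; under eq_integral do rewrite EFinN abseN.
pose Sl (G : L1 mu) := [set g : Linfty mu | Linfty_ball g /\ 1 - 1 < duality g G].
pose S (i : 'I_2) := if i == ord0 then Sl F else Sl F'.
pose C := minkowski_combination (fun _ : 'I_2 => 2^-1) S.
have CC : convex_combination_of_slices C.
  exists 2%N, (fun _ => 2^-1), S; split => //.
  - by move=> _; lra.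
  - by rewrite !big_ord_recl big_ord0/=; lra.
  - by move=> i; rewrite /S; case: ifP => _; [exists F|exists F']; exists 1; split.
have [h hC] := W2 C CC.
have Ch : C h by exact: nbhs_singleton hC.
have hb := subset_convex_combination_ball CC Ch.
have {}hC : \forall k \near (h : weak_star mu), Linfty_ball k -> C k.
  by have : within (@Linfty_ball d T R mu : set (weak_star mu)) (nbhs (h : weak_star mu)) C
    by rewrite nbhs_subspace_in.
(* the trace on the unimodular functions of the neighbourhoods of [h]; it is a
   filter that converges to [h], and [atomless_dense_unimodular] says that it
   is proper *)
pose G : set_system (weak_star mu) := [set U | exists (fs : seq (L1 mu)) (e : R), 0 < e /\
  forall k, Linfty_ball k -> {ae mu, forall x, B x -> `|k x| = 1} ->
    (forall f, f \in fs -> `|duality k f - duality h f| <= e) -> U k].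
have GF : Filter G.
  split.
  - by exists [::], 1.
  - move=> U V [fs [e [e0 HU]]] [fs' [e' [e'0 HV]]].
    exists (fs ++ fs'), (Num.min e e'); split; first by rewrite lt_min e0.
    move=> k kb k1 kf; split; [apply: HU => // f ffs|apply: HV => // f ffs].
      by have := kf f; rewrite mem_cat ffs le_min => /(_ isT)/andP[].
    by have := kf f; rewrite mem_cat ffs orbT le_min => /(_ isT)/andP[].
  - move=> U V UV [fs [e [e0 HU]]]; exists fs, e; split=> // k kb k1 kf.
    by apply: UV; exact: HU.
have Gh : G --> (h : weak_star mu).
  apply: (@weak_star_cvg _ _ _ _ G h GF) => f e e0; exists [:: f], (e / 2).
  split; first by rewrite divr_gt0.
  move=> k _ _ /(_ f (mem_head _ _)) /= le; apply: le_lt_trans le _; lra.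
have [fs [e [e0 HC]]] := Gh _ hC.
have [k [kb k1 kfs]] := atomless_dense_unimodular fs mB Boo Bna hb e0.
have [g Sg kg] := HC k kb k1 kfs kb.
pose i1 : 'I_2 := lift ord0 ord0.
have [g0b g0F] : Sl F (g ord0) by have := Sg ord0.
have [g1b g1F] : Sl F' (g i1) by have := Sg i1.
have : duality (g ord0) F + duality (g i1) F' = 0.
  rewrite (dualityE mb Fb g0b) (dualityE mNb Fb' g1b) -RintegralD//; last 2 first.
  - apply: (@integrable_bounded _ _ _ mu _ _ 1) => //; last exact: clip_le1.
    by apply: measurable_clip; exact: Linfty_measurable.
  - apply: (@integrable_bounded _ _ _ mu _ _ 1) => //; last exact: clip_le1.
    by apply: measurable_clip; exact: Linfty_measurable.
  transitivity (\int[mu]_x (0 : R)); last by rewrite Rintegral_cst// mul0r.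
  apply: ae_eq_Rintegral => //.
  - by apply: measurable_funD; apply: measurable_funM => //; apply: measurable_clip;
      exact: Linfty_measurable.
  (* 1 and -1 are extreme points of [-1, 1] *)
  have g01 : {ae mu, forall x, B x -> g ord0 x = g i1 x}.
    have g1s : {ae mu, forall x, `|g ord0 x| <= 1 /\ `|g i1 x| <= 1}.
      by apply: filterS2 ((ballP _).1 g0b) ((ballP _).1 g1b) => x.
    apply: filterS3 g1s k1 kg => x [gx0 gx1] kx1 /(_ I) + Bx.
    have := kx1 Bx; rewrite !big_ord_recl big_ord0 addr0 -/i1.
    move: gx0 gx1; rewrite !ler_norml => /andP[? ?] /andP[? ?].
    by have [?|?] := leP 0 (k x); [rewrite ger0_norm|rewrite ltr0_norm]; lra.
  apply: filterS3 g01 (ball_clip g0b) (ball_clip g1b) => x gx <-// <-// _.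
  rewrite /b indicE; case: (boolP (x \in B)) => [/set_mem /gx ->|_] /=; lra.
move: g0F g1F; lra.
Qed.

End conclusion.

Theorem theorem4p1 (d : measure_display) (T : measurableType d) (R : realType)
    (mu : {measure set T -> \bar R}) (hmu : localizable mu) :
  [<-> property_Wstar1 mu; property_Wstar2 mu; purely_atomic mu].
Proof.
tfae.
- exact: Wstar1_Wstar2.
- by case: hmu => sf _; exact: Wstar2_purely_atomic.
- exact: purely_atomic_Wstar1.
Qed.
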